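(* Let $c>0$, let $y_n\in\{+1,-1\}$ and let $\tilde{\mathbf x}_n$ be the random corrupted feature vectors in $\mathbb R^D$, $n=1,\dots,N$. For $\mathbf w\in\mathbb R^D$ write $\omega_n(\mathbf w)=\mathbf w^\top\tilde{\mathbf x}_n$. Fix a current parameter $\bar{\mathbf w}\in\mathbb R^D$ with $s_n:=\sqrt{\mathbb E_p[\omega_n(\bar{\mathbf w})^2]}>0$ for all $n$, and let $q(\boldsymbol\lambda)=\prod_{n=1}^N q(\lambda_n)$ with $q(\lambda_n)=\mathcal{PG}(\lambda_n;c,s_n)$ and $\gamma_n:=\mathbb E_q[\lambda_n]$. Then the M-step, i.e. the minimization over $\mathbf w\in\mathbb R^D$ of $$\|\mathbf w\|_2^2+\sum_{n=1}^N\Big(\frac12\,\mathbb E_q[\lambda_n]\,\mathbb E_p[\omega_n(\mathbf w)^2]-\frac c2\,y_n\,\mathbb E_p[\omega_n(\mathbf w)]\Big),$$ is equivalent to (has the same minimizers as) the minimization over $\mathbf w\in\mathbb R^D$ of the $\ell_2$-regularized re-weighted quadratic loss $$\|\mathbf w\|_2^2+\frac c2\sum_{n=1}^N\gamma_n^l\,\mathbb E_p\big[(\mathbf w^\top\tilde{\mathbf x}_n-y_n^l)^2\big],\qquad y_n^l:=\frac{c}{2\gamma_n}\,y_n,\quad \gamma_n^l:=\frac{\gamma_n}{c},$$ and $$\gamma_n=\frac{c}{2s_n}\cdot\frac{e^{s_n}-1}{1+e^{s_n}}.$$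
   Context: Data: $(\mathbf x_n,y_n)$, $n=1,\dots,N$, with $\mathbf x_n\in\mathbb R^D$. Each $\tilde{\mathbf x}_n$ is a random vector in $\mathbb R^D$, drawn from a corrupting distribution $p(\tilde{\mathbf x}_n\mid\mathbf x_n)=\prod_{d=1}^D p(\tilde x_{nd}\mid x_{nd})$ with independent coordinates, finite second moments and $\mathbb E_p[\tilde{\mathbf x}_n]=\mathbf x_n$. $\mathbb E_p$ denotes expectation under the corrupting distribution, $\mathbb E_q$ expectation under $q(\boldsymbol\lambda)$. Any offset of the linear classifier is ignored (or absorbed into $\mathbf w$). Polya-Gamma distributions: for $b>0$, $\mathcal{PG}(b,0)$ is the law on $(0,\infty)$ of $\frac{1}{2\pi^2}\sum_{k=1}^\infty \frac{g_k}{(k-1/2)^2}$ with $g_k$ i.i.d. $\mathrm{Gamma}(b,1)$, and $\mathcal{PG}(\lambda;b,0)$ is its density. For $z\in\mathbb R$, $\mathcal{PG}(\lambda;b,z)$ is the probability density proportional to $e^{-z^2\lambda/2}\,\mathcal{PG}(\lambda;b,0)$. *)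

(* Defs.v *)
From HB Require Import structures.
From mathcomp Require Import all_boot all_order all_algebra.
From mathcomp Require Import all_classical all_reals all_analysis.

Set Implicit Arguments.
Unset Strict Implicit.
Unset Printing Implicit Defensive.

Import Order.TTheory GRing.Theory Num.Theory.
Import numFieldNormedType.Exports.

Local Open Scope classical_set_scope.
Local Open Scope ring_scope.

(* Product rule over every finite subfamily. *)
Definition mutually_independent (d d' : measure_display)
    (T : measurableType d) (T' : measurableType d') (R : realType)
    (P : probability T R) (I : choiceType) (X : I -> {RV P >-> T'}) : Prop :=
  forall (r : seq I) (A : I -> set T'), uniq r ->
    (forall i, measurable (A i)) ->
    P (\bigcap_(i in [set` r]) (X i @^-1` A i)) =
      (\prod_(i <- r) P (X i @^-1` A i))%E.

Definition has_pdf (d : measure_display) (T : measurableType d)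
    (R : realType) (P : probability T R) (X : {RV P >-> R}) (f : R -> R) : Prop :=
  [/\ measurable_fun [set: R] f,
      (forall x, 0 <= f x) &
      forall A : set R, measurable A ->
        distribution P X A = (\int[lebesgue_measure]_(x in A) (f x)%:E)%E].

Definition gamma_fun (R : realType) (b : R) : R :=
  \int[lebesgue_measure]_(x in `]0, +oo[) (x `^ (b - 1) * expR (- x)).

(* Shape b, rate (equivalently, scale) 1. *)
Definition gamma_pdf (R : realType) (b : R) : R -> R :=
  (fun x => x `^ (b - 1) * expR (- x) / gamma_fun b) \_ `]0, +oo[.

(* f is a version of the density of PG(b,0): the law of the almost sure sum of
   the series (2 pi^2)^-1 * \sum_(k >= 1) g_k / (k - 1/2)^2.  Here g is indexed
   from 0, whence k.+1. *)
Definition polya_gamma0_pdf (R : realType) (b : R) (f : R -> R) : Prop :=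
  exists (d : measure_display) (T : measurableType d) (P : probability T R)
    (g : nat -> {RV P >-> R}) (X : {RV P >-> R}),
    [/\ mutually_independent g,
        (forall k, has_pdf (g k) (gamma_pdf b)),
        {ae P, forall t, (fun K : nat => (2 * pi ^+ 2)^-1 *
           \sum_(0 <= k < K) g k t / (k.+1%:R - 2^-1) ^+ 2) @ \oo --> X t} &
        has_pdf X f].

(* f is a version of the density of PG(b,z). *)
Definition polya_gamma_pdf (R : realType) (b z : R) (f : R -> R) : Prop :=
  exists2 f0, polya_gamma0_pdf b f0 &
    (exists C : R, forall x, f x = C * (expR (- (z ^+ 2 * x / 2)) * f0 x)) /\
    (\int[lebesgue_measure]_x (f x)%:E)%E = 1%E.

Definition polya_gamma_distributed (d : measure_display) (T : measurableType d)
    (R : realType) (P : probability T R) (X : {RV P >-> R}) (b z : R) : Prop :=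
  exists2 f, polya_gamma_pdf b z f & has_pdf X f.

(* X n i is the i-th coordinate of the n-th random vector of R^D; nothing is
   assumed on the joint law of distinct vectors. *)
Definition corruption (d : measure_display) (T : measurableType d)
    (R : realType) (P : probability T R) (N D : nat)
    (x : 'I_N -> 'cV[R]_D) (X : 'I_N -> 'I_D -> {RV P >-> R}) : Prop :=
  [/\ (forall n, mutually_independent (X n)),
      (forall n i, (X n i : T -> R) \in Lfun P 2%:E) &
      forall n i, ('E_P[X n i] = (x n i 0)%:E)%E].

Definition omega (d : measure_display) (T : measurableType d)
    (R : realType) (P : probability T R) (N D : nat)
    (X : 'I_N -> 'I_D -> {RV P >-> R}) (n : 'I_N) (w : 'cV[R]_D) : T -> R :=
  fun t => (w^T *m \col_i X n i t) 0 0.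

(* The norm `|w| of the library on matrices is the sup norm. *)
Definition sqnorm2 (R : realType) (D : nat) (w : 'cV[R]_D) : R :=
  \sum_i w i 0 ^+ 2.

Definition minimizer (V : Type) (R : realType) (J : V -> R) (w : V) : Prop :=
  forall v, J w <= J v.

(* The library expectation is extended-real valued; here and below fine is only
   applied to expectations which are finite in the situations considered. *)
Definition mstep_objective (d d' : measure_display)
    (T : measurableType d) (T' : measurableType d') (R : realType)
    (P : probability T R) (Q : probability T' R) (N D : nat)
    (X : 'I_N -> 'I_D -> {RV P >-> R}) (lambda : 'I_N -> {RV Q >-> R})
    (y : 'I_N -> R) (c : R) (w : 'cV[R]_D) : R :=
  sqnorm2 w +
  \sum_n (2^-1 * fine 'E_Q[lambda n] *
            fine 'E_P[fun t => omega X n w t ^+ 2]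
          - c / 2 * y n * fine 'E_P[omega X n w]).

Definition reweighted_objective (d : measure_display)
    (T : measurableType d) (R : realType) (P : probability T R) (N D : nat)
    (X : 'I_N -> 'I_D -> {RV P >-> R}) (yl gammal : 'I_N -> R) (c : R)
    (w : 'cV[R]_D) : R :=
  sqnorm2 w +
  c / 2 * \sum_n gammal n * fine 'E_P[fun t => (omega X n w t - yl n) ^+ 2].

(* Main.v *)
(** The two objectives differ by a constant independent of w: expanding the
    square, gamma^l_n y^l_n = y_n / 2 because gamma_n <> 0. Everything else is
    the computation of gamma_n.

    If X = (2 pi^2)^-1 \sum_k g_k / (k - 1/2)^2 has law PG(b,0), independence
    and E e^(- th g_k) = (1 + th)^(-b) give
      E e^(- s^2 X / 2) = \prod_k (1 + s^2 / (4 pi^2 (k - 1/2)^2))^(-b)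
                        = cosh (s / 2)^(-b),
    the last step being Euler's product for cosh, obtained by squeezing from
    the finite identity
      cosh x = \prod_(0 <= k < n) (1 + sinh^2 (x / 2n) / sin^2 th_k)
    with th_k = (2k + 1) pi / 4n. The density of PG(b,s) is that of PG(b,0)
    times e^(- s^2 x / 2) / E e^(- s^2 X / 2), so its mean is
    E[X e^(- s^2 X / 2)] / E e^(- s^2 X / 2), i.e. minus the logarithmic
    derivative in s of cosh (s / 2)^(-b), divided by s, which is
    b / (2 s) tanh (s / 2). *)

Require Import Defs.
From HB Require Import structures.
From mathcomp Require Import all_boot all_order all_algebra.
From mathcomp Require Import all_classical all_reals all_analysis.
From mathcomp Require Import measurable_realfun.
From mathcomp Require Import ring lra.

Set Implicit Arguments.
Unset Strict Implicit.
Unset Printing Implicit Defensive.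

Import Order.TTheory GRing.Theory Num.Theory.
Import numFieldNormedType.Exports.
Import HBNNSimple.

Local Open Scope classical_set_scope.
Local Open Scope ring_scope.

(** * Integration against image measures with a density *)

(** For indicators the identity is the assumption on [nu]; additivity extends it to simple
    functions, monotone convergence to nonnegative measurable functions. Having both [phi] and [W]
    covers weighted laws of a random variable as well as densities ([phi] the identity). *)
Lemma ge0_integral_density d d' (T : measurableType d) (T' : measurableType d')
    (R : realType) (mu : {measure set T -> \bar R})
    (nu : {measure set T' -> \bar R}) (phi : T -> T') (W : T -> R)
    (h : T' -> \bar R) :
  measurable_fun [set: T] phi -> measurable_fun [set: T] W ->
  (forall t, 0 <= W t) ->
  (forall A, measurable A ->
    nu A = \int[mu]_(t in phi @^-1` A) (W t)%:E)%E ->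
  measurable_fun [set: T'] h -> (forall y, 0 <= h y)%E ->
  (\int[nu]_y h y = \int[mu]_t (h (phi t) * (W t)%:E))%E.
Proof.
move=> mphi mW' W0 nuE mh h0.
have mW : measurable_fun [set: T] (EFin \o W) by exact/measurable_EFinP.
have step (g : {nnsfun T' >-> R}) :
    (\int[nu]_y (g y)%:E = \int[mu]_t ((g (phi t))%:E * (W t)%:E))%E.
  rewrite integralT_nnsfun sintegralE.
  have gE t : ((g (phi t))%:E * (W t)%:E =
      \sum_(r \in range g)
        (r * \1_(g @^-1` [set r]) (phi t))%:E * (W t)%:E)%E.
    by rewrite (fimfunE g) -fsumEFin// ge0_mule_fsuml// => r;
      exact: nnfun_muleindic_ge0.
  under [RHS]eq_integral do rewrite gE.
  have mind r : measurable_fun [set: T]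
      (fun t => (r * \1_(g @^-1` [set r]) (phi t))%:E * (W t)%:E)%E.
    apply: emeasurable_funM => //; apply/measurable_EFinP.
    apply: measurable_funM => //.
    exact: (@measurableT_comp _ _ _ _ _ _ (\1_(g @^-1` [set r]) : T' -> R)).
  rewrite ge0_integral_fsum//=; last first.
    move=> r t _; apply: mule_ge0; last by rewrite lee_fin.
    exact: nnfun_muleindic_ge0.
  apply: eq_fsbigr => r /set_mem[t0 _ <-].
  have mpre : measurable (phi @^-1` (g @^-1` [set g t0])).
    by rewrite -[X in measurable X]setTI; apply: mphi => //;
      exact: measurable_sfunP.
  rewrite nuE; last exact: measurable_sfunP.
  rewrite [in LHS]integral_mkcond -ge0_integralZl//.
  - apply: eq_integral => t _; rewrite patchE /= indicE.
    have -> : (t \in phi @^-1` (g @^-1` [set g t0])) =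
      (phi t \in g @^-1` [set g t0]) by apply/idP/idP; rewrite !inE.
    by case: ifPn => _; rewrite ?mulr1 ?mulr0 ?mul0e ?mule0.
  - by apply/(measurable_restrictT _ _).1 => //; exact: measurable_funTS.
  - by move=> t _; apply: erestrict_ge0 => u _; rewrite lee_fin.
  - by rewrite lee_fin.
have mhphi : measurable_fun [set: T] (h \o phi) by exact: measurableT_comp.
pose g := nnsfun_approx measurableT mh.
have gnd y m n : (m <= n)%N -> g m y <= g n y.
  by move=> mn; move/lefP: (nd_nnsfun_approx measurableT mh mn); apply.
transitivity (limn (fun n => \int[nu]_y (g n y)%:E))%E.
  rewrite -monotone_convergence//.
  - by apply: eq_integral => y _; apply/esym/cvg_lim => //;
      exact: cvg_nnsfun_approx.
  - by move=> n; exact/measurable_EFinP.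
  - by move=> n y _; rewrite lee_fin.
  - by move=> y _ m n mn; rewrite lee_fin gnd.
under eq_fun do rewrite step.
rewrite -monotone_convergence//.
- apply: eq_integral => t _; apply/cvg_lim => //.
  by apply: cvgeZr => //; exact: cvg_nnsfun_approx.
- move=> n; apply: emeasurable_funM => //; apply/measurable_EFinP.
  exact: measurableT_comp.
- by move=> n t _; rewrite -EFinM lee_fin mulr_ge0.
- by move=> t _ m n mn; rewrite -!EFinM lee_fin ler_wpM2r// gnd.
Qed.

(** * Expectations of products of independent variables *)

Section independence.
Context d d' (T : measurableType d) (T' : measurableType d') (R : realType).
Context (P : probability T R) (I : choiceType) (X : I -> {RV P >-> T'}).
Context (indX : mutually_independent X) (h : I -> T' -> R).
Context (mh : forall i, measurable_fun [set: T'] (h i)).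
Context (h01 : forall i x, 0 <= h i x <= 1).

Let mhX i : measurable_fun [set: T] (fun t => h i (X i t)).
Proof. exact: (measurableT_comp (mh i)). Qed.

(** Replacing indicators by functions one index at a time: for fixed remaining
    factors, both sides are measures in the set attached to the index. *)
Let expectation_prod_indic (r r' : seq I) (A : I -> set T') :
  uniq (r ++ r') -> (forall i, measurable (A i)) ->
  (\int[P]_t (\prod_(i <- r) h i (X i t) *
              \prod_(i <- r') \1_(A i) (X i t))%:E =
   \prod_(i <- r) (\int[P]_t (h i (X i t))%:E) *
   \prod_(i <- r') P (X i @^-1` A i))%E.
Proof.
elim: r r' A => [|j r IH] r' A /= => [ur'|/andP[jrr' ur]] mA.
  rewrite big_nil mul1e -(indX ur' mA).
  under eq_integral do rewrite big_nil mul1r.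
  have mcap : measurable (\bigcap_(i in [set` r']) X i @^-1` A i).
    apply: fin_bigcap_measurable => // i _; rewrite -[X in measurable X]setTI.
    exact: measurable_funPT.
  rewrite -[in RHS](setIT (\bigcap_(i in [set` r']) X i @^-1` A i)).
  rewrite -integral_indic//.
  apply: eq_integral => t _; congr EFin.
  (* A product of indicators is the indicator of the intersection. *)
  rewrite indicE; have [/set_mem ht|/negP ht] := boolP (t \in _).
    by rewrite big1_seq// => i /andP[_ ir]; rewrite indicE mem_set//; exact: ht.
  have [i ir /negP hi] : exists2 i, i \in r' & t \notin X i @^-1` A i.
    apply: contrapT => H; apply: ht; apply/mem_set => i /= ir.
    by apply: contrapT => hi; apply: H; exists i => //; apply/negP => /set_mem.
  apply/eqP; rewrite prodf_seq_eq0; apply/hasP; exists i => //=.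
  by rewrite indicE; case: (boolP (_ \in _)).
pose W t := \prod_(i <- r) h i (X i t) * \prod_(i <- r') \1_(A i) (X i t).
have W0 t : 0 <= W t.
  by rewrite mulr_ge0// prodr_ge0// => i _; case/andP: (h01 i (X i t)).
have W1 t : W t <= 1.
  rewrite mulr_ile1// ?prodr_ge0// => [i _||].
  - by case/andP: (h01 i (X i t)).
  - by rewrite prodr_ile1.
  - by rewrite prodr_ile1// => i _; rewrite indicE ler0n lern1 leq_b1.
have mW : measurable_fun [set: T] W.
  apply: measurable_funM; apply: measurable_prod => //= i _.
  exact: (@measurableT_comp _ _ _ _ _ _ (\1_(A i) : T' -> R)).
have kE := IH r' A ur mA.
set k := (X in _ = X) in kE.
have k0 : (0 <= k)%E.
  by rewrite -kE; apply: integral_ge0 => t _; rewrite lee_fin W0.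
have kfin : k \is a fin_num.
  rewrite ge0_fin_numE// -kE (@le_lt_trans _ _ (\int[P]_t (cst 1%E t))%E)//.
    apply: ge0_le_integral => //; last by move=> t _; rewrite lee_fin W1.
      by move=> t _; rewrite lee_fin W0.
    exact/measurable_EFinP.
  by rewrite integral_cst//= mul1e probability_setT ltry.
have fk0 : 0 <= fine k by rewrite fine_ge0.
(* By the induction hypothesis with [j] put among the indicators, [nu] is the image under [X j] of
   the measure with density [W]; integrating [h j] against it brings in the new factor. *)
pose nu := mscale (NngNum fk0) (distribution P (X j)).
have nuE B : measurable B ->
    nu B = (\int[P]_(t in X j @^-1` B) (W t)%:E)%E.
  (* The sets attached to [r'] are unchanged, as [j] is not in [r']. *)
  move=> mB; pose A' i := if i == j then B else A i.
  have jr' : uniq (r ++ j :: r').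
    by rewrite uniq_catC cat_cons /= mem_cat orbC -mem_cat jrr' uniq_catC.
  have A'E i : i \in r' -> A' i = A i.
    move=> ir'; rewrite /A'; case: eqP => // ij; move: jrr'.
    by rewrite -ij mem_cat ir' orbT.
  have mA' i : measurable (A' i) by rewrite /A'; case: ifP.
  have mXB : measurable (X j @^-1` B).
    by rewrite -[X in measurable X]setTI; exact: measurable_funPT.
  rewrite integral_mkcond.
  transitivity (\int[P]_t (\prod_(i <- r) h i (X i t) *
      \prod_(i <- j :: r') \1_(A' i) (X i t))%:E)%E; last first.
    apply: eq_integral => t _; rewrite patchE /W big_cons.
    have -> : \prod_(i <- r') \1_(A' i) (X i t) =
        \prod_(i <- r') \1_(A i) (X i t) :> R.
      by apply: eq_big_seq => i ir'; rewrite A'E.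
    rewrite /A' eqxx indicE.
    have -> : (t \in X j @^-1` B) = (X j t \in B).
      by apply/idP/idP; rewrite !inE.
    by case: ifPn => _; rewrite ?mul1r// mul0r mulr0.
  rewrite (IH _ _ jr' mA') big_cons.
  have -> : (\prod_(i <- r') P (X i @^-1` A' i) =
      \prod_(i <- r') P (X i @^-1` A i))%E.
    by apply: eq_big_seq => i ir'; rewrite A'E.
  rewrite {1}/A' eqxx muleCA [in RHS]muleC.
  by rewrite /nu /mscale/= fineK.
have mhj : measurable_fun [set: T'] (EFin \o h j) by exact/measurable_EFinP.
have hj0 y : (0 <= (EFin \o h j) y)%E by rewrite lee_fin; case/andP: (h01 j y).
have mXj : measurable_fun [set: T] (X j) by exact: measurable_funPT.
have := ge0_integral_density mXj mW W0 nuE mhj hj0.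
rewrite ge0_integral_mscale// ge0_integral_distribution//= fineK// => nuh.
rewrite big_cons -muleA -/k [RHS]muleC nuh.
by apply: eq_integral => t _; rewrite big_cons -EFinM mulrA.
Qed.

Lemma expectation_prod_independent (r : seq I) : uniq r ->
  (\int[P]_t (\prod_(i <- r) h i (X i t))%:E =
   \prod_(i <- r) (\int[P]_t (h i (X i t))%:E))%E.
Proof.
move=> ur; have := @expectation_prod_indic r [::] (fun=> setT).
rewrite cats0 big_nil mule1 => <- //.
by apply: eq_integral => t _; rewrite big_nil mulr1.
Qed.

End independence.

(** * Densities on the line and the Laplace transform of the gamma law *)

Lemma ge0_integral_pdf d (T : measurableType d) (R : realType)
    (P : probability T R) (X : {RV P >-> R}) (f : R -> R) (h : R -> \bar R) :
  has_pdf X f -> measurable_fun [set: R] h -> (forall x, 0 <= h x)%E ->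
  (\int[P]_t h (X t) = \int[lebesgue_measure]_x (h x * (f x)%:E))%E.
Proof.
move=> [mf f0 Xf] mh h0.
rewrite -(@ge0_integral_density _ _ _ _ _ lebesgue_measure (distribution P X)
  (fun x => x) f h)//.
by rewrite ge0_integral_distribution.
Qed.

(** Lebesgue measure is [a] times its own image under multiplication by [a], since the two agree on
    half-open intervals. *)
Lemma ge0_integral_lebesgue_scale (R : realType) (a : R) (f : R -> \bar R) :
  0 < a -> measurable_fun [set: R] f -> (forall x, 0 <= f x)%E ->
  (\int[lebesgue_measure]_x f x = a%:E * \int[lebesgue_measure]_x f (a * x)%R)%E.
Proof.
move=> a0 mf f0.
pose phi : R -> measurableTypeR R := fun x => a * x.
have mphi : measurable_fun [set: R] phi by exact: mulrl_measurable.
rewrite (eq_measure_integral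
    (mscale (PosNum a0)%:num%:nng (pushforward lebesgue_measure phi))); last first.
  move=> A mA _; apply: lebesgue_measure_unique => //= _ [[x y]] _ <-.
  rewrite /mscale /= /pushforward.
  have -> : phi @^-1` `]x, y]%classic = `](x / a), (y / a)]%classic.
    apply/seteqP; split => z /=; rewrite !in_itv /= /phi ltr_pdivrMr//;
      by rewrite ler_pdivlMr// mulrC.
  rewrite !lebesgue_measure_itv/= !lte_fin ltr_pM2r ?invr_gt0//.
  case: ifPn => _; rewrite ?mule0// -!EFinB -EFinM; congr EFin; field.
  by rewrite gt_eqF.
by rewrite ge0_integral_mscale//= ge0_integral_pushforward.
Qed.

(** Truncating [g] at 0, which is harmless almost surely, makes the integrand
    bounded by 1 everywhere. *)
Lemma gamma_pdf_laplace d (T : measurableType d) (R : realType)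
    (P : probability T R) (b th : R) (g : {RV P >-> R}) :
  has_pdf g (gamma_pdf b) -> 0 <= th ->
  (\int[P]_t (expR (- (th * Num.max (g t) 0)))%:E = ((1 + th) `^ (- b))%:E)%E.
Proof.
move=> gpdf th0; have [mpdf pdf0 gE] := gpdf.
have k0 : 0 < 1 + th by rewrite ltr_wpDr.
rewrite (ge0_integral_pdf
  (h := fun x => (expR (- (th * Num.max x 0)))%:E) gpdf); last 2 first.
- apply/measurable_EFinP; apply: measurableT_comp => //.
  apply: measurableT_comp => //; apply: measurable_funM => //.
  exact: measurable_maxr.
- by move=> x; rewrite lee_fin expR_ge0.
have int1 : (\int[lebesgue_measure]_x (gamma_pdf b x)%:E = 1)%E.
  by rewrite -gE// /distribution /pushforward preimage_setT probability_setT.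
have mpdfk : measurable_fun [set: R] (fun x => gamma_pdf b ((1 + th) * x)).
  by apply: (measurableT_comp mpdf); exact: mulrl_measurable.
(* Multiplying the gamma density by [e^(- th x)] amounts to rescaling it by [1 + th], up to the
   power left by [x ^ (b - 1)]. *)
transitivity (\int[lebesgue_measure]_x
    (((1 + th) `^ (1 - b))%:E * (gamma_pdf b ((1 + th) * x))%:E))%E.
  apply: eq_integral => x _; rewrite -!EFinM; congr EFin.
  rewrite /gamma_pdf !patchE !mem_setE !in_itv /= !andbT pmulr_rgt0//.
  case: ifPn => x0; last by rewrite !mulr0.
  rewrite max_l ?(ltW x0)// powRM ?ltW//.
  have -> : (1 + th) `^ (1 - b) * ((1 + th) `^ (b - 1) * x `^ (b - 1) *
      expR (- ((1 + th) * x)) / gamma_fun b) =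
    ((1 + th) `^ (1 - b) * (1 + th) `^ (b - 1)) * (x `^ (b - 1) *
      expR (- ((1 + th) * x)) / gamma_fun b) by ring.
  rewrite -powRD; last by rewrite (gt_eqF k0) implybT.
  have -> : 1 - b + (b - 1) = 0 by ring.
  rewrite powRr0 mul1r mulrDl mul1r opprD expRD; ring.
rewrite ge0_integralZl//; last 3 first.
- exact/measurable_EFinP.
- by move=> x _; rewrite lee_fin.
- by rewrite lee_fin powR_ge0.
(* The rescaled density has mass [(1 + th)^-1], which turns the exponent [1 - b] into [- b]. *)
have h : (1 = (1 + th)%:E *
    \int[lebesgue_measure]_x (gamma_pdf b ((1 + th) * x))%:E)%E.
  rewrite -int1; apply: (@ge0_integral_lebesgue_scale R (1 + th)
    (EFin \o gamma_pdf b)) => //; exact/measurable_EFinP.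
have {}h : (\int[lebesgue_measure]_x (gamma_pdf b ((1 + th) * x))%:E =
    ((1 + th)^-1)%:E)%E.
  rewrite -[LHS]mul1e -[X in (X * _)%E](_ : ((1 + th)^-1 * (1 + th))%:E = _).
    by rewrite EFinM -muleA -h mule1.
  by rewrite mulVf// gt_eqF.
rewrite h -EFinM; congr EFin.
rewrite -powR_inv1 ?ltW// -powRD; last by rewrite (gt_eqF k0) implybT.
by congr (_ `^ _); ring.
Qed.

(** * Hyperbolic functions and elementary inequalities *)

Section cosh_product.
Context {R : realType}.
Implicit Types (x y u t : R) (n k : nat).

Definition cosh x : R := (expR x + expR (- x)) / 2.
Definition sinh x : R := (expR x - expR (- x)) / 2.

Lemma cosh0 : cosh 0 = 1.
Proof. by rewrite /cosh oppr0 expR0 -[2]/(1 + 1) divff. Qed.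

Lemma sinh0 : sinh 0 = 0.
Proof. by rewrite /sinh oppr0 expR0 subrr mul0r. Qed.

Lemma cosh_ge1 x : 1 <= cosh x.
Proof.
have := expR_ge1Dx x; have := expR_ge1Dx (- x); rewrite /cosh; lra.
Qed.

Lemma cosh_gt0 x : 0 < cosh x. Proof. exact: lt_le_trans ltr01 (cosh_ge1 x). Qed.

Lemma sinh_ge0 x : 0 <= x -> 0 <= sinh x.
Proof.
move=> x0; rewrite /sinh divr_ge0// subr_ge0 ler_expR; lra.
Qed.

Lemma cosh_mul2n x : cosh (2 * x) = 1 + 2 * sinh x ^+ 2.
Proof.
rewrite /cosh /sinh (_ : 2 * x = x + x); last by ring.
rewrite opprD !expRD expRN.
have := expR_gt0 x; move: (expR x) => e e0; field; rewrite gt_eqF//.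
Qed.

#[global] Instance is_derive_cosh x : is_derive x 1 cosh (sinh x).
Proof.
rewrite /cosh /sinh; apply: is_derive_eq; rewrite /GRing.scale /=; lra.
Qed.

#[global] Instance is_derive_sinh x : is_derive x 1 sinh (cosh x).
Proof.
rewrite /cosh /sinh; apply: is_derive_eq; rewrite /GRing.scale /=; lra.
Qed.

(** The mean value theorem on [[0, x]]. The comparisons of [sinh] and [sin] with their arguments
    rest on it. *)
Lemma ge0_of_derive_ge0 (f f' : R -> R) x :
  f 0 = 0 -> (forall t, is_derive t 1 f (f' t)) ->
  (forall t, 0 <= t <= x -> 0 <= f' t) -> 0 <= x -> 0 <= f x.
Proof.
move=> f00 df f'0 x0.
have [t tx] := MVT_segment x0 (fun t _ => df t)
  (derivable_within_continuous (fun t _ => @ex_derive _ _ _ _ _ _ _ (df t))).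
rewrite f00 !subr0 => ->; by rewrite mulr_ge0// f'0.
Qed.

Lemma sinh_ge x : 0 <= x -> x <= sinh x.
Proof.
move=> x0; rewrite -subr_ge0.
apply: (@ge0_of_derive_ge0 (fun t => sinh t - t) (fun t => cosh t - 1)) => //.
- by rewrite sinh0 subr0.
- by move=> t; rewrite subr_ge0 cosh_ge1.
Qed.

Lemma sinh_le x : 0 <= x -> sinh x <= x * cosh x.
Proof.
move=> x0; rewrite -subr_ge0.
apply: (@ge0_of_derive_ge0 (fun t => t * cosh t - sinh t)
  (fun t => t * sinh t)) => //.
- by rewrite sinh0 mul0r subr0.
- by move=> t; apply: is_derive_eq; rewrite /GRing.scale /=; ring.
- by move=> t /andP[t0 _]; rewrite mulr_ge0// sinh_ge0.
Qed.

Lemma sin_le_id x : 0 <= x -> sin x <= x.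
Proof.
move=> x0; rewrite -subr_ge0.
apply: (@ge0_of_derive_ge0 (fun t => t - sin t) (fun t => 1 - cos t)) => //.
by rewrite sin0 subr0.
Qed.

Lemma id_mul_cos_le_sin x : 0 <= x <= pi -> x * cos x <= sin x.
Proof.
move=> /andP[x0 xpi]; rewrite -subr_ge0.
apply: (@ge0_of_derive_ge0 (fun t => sin t - t * cos t)
  (fun t => t * sin t)) => //.
- by rewrite sin0 mul0r subr0.
- by move=> t; apply: is_derive_eq; rewrite /GRing.scale /=; ring.
- move=> t /andP[t0 tx]; rewrite mulr_ge0// sin_ge0_pi// t0/=.
  exact: le_trans xpi.
Qed.

(** Squaring [x cos x <= sin x] gives [x^2 (1 - sin^2 x) <= sin^2 x], that is
    [x^2 <= (1 + x^2) sin^2 x]. *)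
Lemma invr_sin_sqr_le x : 0 < x < pi / 2 ->
  (sin x ^+ 2)^-1 <= (x ^+ 2)^-1 + 1.
Proof.
move=> /andP[x0 xpi]; have pi0 := @pi_gt0 R.
have sx : 0 < sin x by rewrite sin_gt0_pihalf// x0.
have xc : x * cos x <= sin x.
  by rewrite id_mul_cos_le_sin// ltW//= ltW// (lt_trans xpi)//; lra.
have c0 : 0 <= cos x by rewrite cos_ge0_pihalf// !ltW//; lra.
have -> : (x ^+ 2)^-1 + 1 = (1 + x ^+ 2) / x ^+ 2 by field; rewrite gt_eqF.
rewrite ler_pdivlMr ?exprn_gt0// mulrC ler_pdivrMr ?exprn_gt0//.
suff : x ^+ 2 * cos x ^+ 2 <= sin x ^+ 2 by rewrite cos2sin2; lra.
by rewrite -exprMn lerXn2r// ?nnegrE ?mulr_ge0// ltW.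
Qed.

(** * Chebyshev polynomials and the finite product for cosh *)

(** Both cos and cosh satisfy the recurrence, so that factoring these polynomials
    at the real roots provided by cos yields a finite product for cosh. *)
Fixpoint chebyshev n : {poly R} :=
  if n is m.+1 then
    if m is k.+1 then 2%:R *: 'X * chebyshev m - chebyshev k else 'X
  else 1.

Lemma size_chebyshev n : (size (chebyshev n) <= n.+1)%N.
Proof.
suff : (size (chebyshev n) <= n.+1)%N && (size (chebyshev n.+1) <= n.+2)%N.
  by case/andP.
elim: n => [|n /andP[IH1 IH2]]; first by rewrite size_poly1 size_polyX.
rewrite IH2 [chebyshev n.+2]/= -/(chebyshev n.+1).
rewrite (leq_trans (size_polyD _ _))// size_polyN geq_max.
rewrite (leq_trans IH1) ?andbT; last by rewrite ltnW.
rewrite -scalerAl (leq_trans (size_scale_leq _ _))//.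
rewrite (leq_trans (size_polyMleq _ _))// size_polyX.
by rewrite -subn1 leq_subLR.
Qed.

(** Both sides obey the same two-step recurrence with the same initial values. [C m] will be
    [cos (m t)] and [cosh (m u)]. *)
Lemma horner_chebyshev (C : nat -> R) n : C 0%N = 1 ->
  (forall m, C m.+2 = 2 * C 1%N * C m.+1 - C m) ->
  (chebyshev n).[C 1%N] = C n.
Proof.
move=> C0 CS.
suff : (chebyshev n).[C 1%N] = C n /\ (chebyshev n.+1).[C 1%N] = C n.+1.
  by case.
elim: n => [|n [IH1 IH2]]; first by rewrite C0 hornerE /= hornerX.
split=> //; rewrite [chebyshev n.+2]/= -/(chebyshev n.+1).
by rewrite !hornerE IH1 IH2 CS.
Qed.

Lemma chebyshev_cos n t : (chebyshev n).[cos t] = cos (n%:R * t).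
Proof.
have := @horner_chebyshev (fun n => cos (n%:R * t)) n; rewrite mul1r; apply.
  by rewrite mul0r cos0.
move=> m; rewrite -[m.+2%:R]natr1 -[m.+1%:R]natr1.
rewrite !mulrDl !mul1r !cosD !sinD; have := cos2Dsin2 t.
move: (cos (_ * t)) (sin (_ * t)) (cos t) (sin t) => a b c d cd.
apply/eqP; rewrite -subr_eq0; apply/eqP.
transitivity (a * (1 - (c ^+ 2 + d ^+ 2))); first by ring.
by rewrite cd subrr mulr0.
Qed.

Lemma chebyshev_cosh n u : (chebyshev n).[cosh u] = cosh (n%:R * u).
Proof.
have := @horner_chebyshev (fun n => cosh (n%:R * u)) n; rewrite mul1r; apply.
  by rewrite mul0r cosh0.
move=> m; rewrite -[m.+2%:R]natr1 -[m.+1%:R]natr1.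
rewrite /cosh !mulrDl !mul1r !opprD !expRD !expRN.
have := expR_gt0 (m%:R * u); have := expR_gt0 u.
move: (expR _) (expR _) => a b a0 b0; field; by rewrite ?gt_eqF.
Qed.

(** The [n] distinct numbers [cos (th k)] are the roots of [chebyshev n]. Dividing its value at
    [cosh u] by its value at 1, which is 1, cancels the leading coefficient. *)
Lemma cosh_nat_mul n u : (0 < n)%N ->
  cosh (n%:R * u) = \prod_(0 <= k < n)
    (1 + (cosh u - 1) / (1 - cos (k.*2.+1%:R * pi / (2 * n%:R)))).
Proof.
move=> n0; pose th k : R := k.*2.+1%:R * pi / (2 * n%:R).
have n0' : 0 < n%:R :> R by rewrite ltr0n.
have pi0 := @pi_gt0 R.
have th_in k : (k < n)%N -> th k \in `[0, pi].
  move=> kn; rewrite in_itv /= /th divr_ge0 ?mulr_ge0// ?(ltW pi0)//=.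
  rewrite ler_pdivrMr ?mulr_gt0// mulrC ler_wpM2l ?(ltW pi0)// -natrM ler_nat.
  by rewrite mul2n ltn_double.
have th_gt0 k : 0 < th k by rewrite /th divr_gt0 ?mulr_gt0.
have th_inj k l : th k = th l -> k = l.
  have c0 : pi / (2 * n%:R) != 0 :> R by rewrite gt_eqF// divr_gt0// mulr_gt0.
  move=> h; have : k.*2.+1%:R = l.*2.+1%:R :> R.
    by apply: (mulIf c0); rewrite !mulrA.
  by move/eqP; rewrite eqr_nat eqSS => /eqP/double_inj.
pose rs := [seq cos (th k) | k <- iota 0 n].
have urs : uniq rs.
  rewrite map_inj_in_uniq ?iota_uniq// => k l; rewrite !mem_iota !add0n /=.
  by move=> kn ln /(cos_inj (th_in _ kn) (th_in _ ln))/th_inj.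
have rootrs : all (root (chebyshev n)) rs.
  apply/allP => _ /mapP[k _ ->]; rewrite rootE chebyshev_cos.
  (* An odd multiple of [pi / 2], hence a zero of [cos]. *)
  have -> : n%:R * th k = pi / 2 + pi *+ k.
    rewrite /th -addn1 natrD -mul2n natrM -[pi *+ k]mulr_natr; field.
    by rewrite gt_eqF.
  elim: k => [|k IH]; first by rewrite mulr0n addr0 cos_pihalf.
  by rewrite [pi *+ k.+1]mulrSr addrA cosDpi oppr_eq0.
have ch1 : (chebyshev n).[1] = 1.
  by rewrite -cosh0 chebyshev_cosh mulr0.
have chn0 : chebyshev n != 0.
  apply/eqP => ch0; move: ch1; rewrite ch0 horner0 => /eqP.
  by rewrite eq_sym oner_eq0.
have srs : size rs = n by rewrite size_map size_iota.
(* The degree is at most [n] and there are [n] distinct roots, so the degree is [n] and the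
   polynomial splits. *)
have sz : size (chebyshev n) = (size rs).+1.
  apply/eqP; rewrite eqn_leq {1}srs size_chebyshev/=.
  exact: max_poly_roots.
have := all_roots_prod_XsubC sz rootrs; rewrite uniq_rootsE => /(_ urs) chE.
set l := lead_coef _ in chE.
have hornE v : (chebyshev n).[v] = l * \prod_(0 <= k < n) (v - cos (th k)).
  rewrite chE hornerZ horner_prod big_map /index_iota subn0; congr (_ * _).
  by apply: eq_bigr => k _; rewrite hornerXsubC.
have c1 k : (k < n)%N -> 1 - cos (th k) != 0.
  move=> kn; rewrite subr_eq0 -cos0 eq_sym.
  apply/eqP => /cos_inj -/(_ (th_in _ kn)).
  rewrite in_itv/= lexx (ltW pi0) => /(_ isT) thk.
  by have := th_gt0 k; rewrite thk ltxx.
transitivity ((chebyshev n).[cosh u] / (chebyshev n).[1]).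
  by rewrite ch1 divr1 chebyshev_cosh.
rewrite !hornE.
have l0 : l != 0 by rewrite lead_coef_eq0.
rewrite -mulf_div divff// mul1r -prodf_div.
apply: eq_big_nat => k /andP[_ kn].
rewrite -/(th k); field; exact: c1.
Qed.

(** The previous product at [u = x / n], rewritten by [cosh 2v - 1 = 2 sinh^2 v] and
    [1 - cos 2t = 2 sin^2 t]. *)
Lemma cosh_prod_sinh_sin n x : (0 < n)%N ->
  cosh x = \prod_(0 <= k < n) (1 + sinh (x / (2 * n%:R)) ^+ 2 /
                                sin (k.*2.+1%:R * pi / (4 * n%:R)) ^+ 2).
Proof.
move=> n0; have n0' : n%:R != 0 :> R by rewrite pnatr_eq0 -lt0n.
have -> : x = n%:R * (2 * (x / (2 * n%:R))) by field.
rewrite cosh_nat_mul// cosh_mul2n; apply: eq_bigr => k _.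
have -> : n%:R * (2 * (x / (2 * n%:R))) / (2 * n%:R) = x / (2 * n%:R) by field.
have -> : k.*2.+1%:R * pi / (2 * n%:R) =
    (k.*2.+1%:R * pi / (4 * n%:R)) *+ 2 :> R by rewrite -mulr_natr; field.
rewrite cos_mulr2n cos2sin2; move: (sinh _ ^+ 2) (sin _ ^+ 2) => S s.
have -> : 1 + 2 * S - 1 = 2 * S by ring.
have -> : 1 - ((1 - s) *+ 2 - 1) = 2 * s by rewrite -mulr_natr; ring.
by rewrite -mulf_div divff// mul1r.
Qed.

(** * Euler's infinite product for cosh *)

Lemma sum_le_prod1D (a : nat -> R) n : (forall k, 0 <= a k) ->
  1 + \sum_(0 <= k < n) a k <= \prod_(0 <= k < n) (1 + a k).
Proof.
move=> a0; elim: n => [|n IH]; first by rewrite !big_geq// addr0.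
rewrite !big_nat_recr//= mulrDr mulr1 addrA lerD// -[leLHS]mul1r ler_wpM2r//.
by rewrite (le_trans _ IH)// lerDl sumr_ge0.
Qed.

(** The coefficients of Euler's product [cosh x = \prod_k (1 + x^2 / (pi^2 (k + 1/2)^2))], written
    with the shift used in the Polya-Gamma series. *)
Definition cosh_coef x k := x ^+ 2 / (pi * (k.+1%:R - 2^-1)) ^+ 2.

Lemma cosh_coef_ge0 x k : 0 <= cosh_coef x k.
Proof. by rewrite divr_ge0// sqr_ge0. Qed.

Let angle n k : R := k.*2.+1%:R * pi / (4 * n%:R).

Let angle_gt0 n k : (0 < n)%N -> 0 < angle n k.
Proof. by move=> n0; rewrite divr_gt0// mulr_gt0 ?pi_gt0// ltr0n. Qed.

Let angle_lt n k : (k < n)%N -> angle n k < pi / 2.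
Proof.
move=> kn; have n0 : (0 < n)%N by exact: leq_trans kn.
rewrite /angle ltr_pdivrMr; last by rewrite mulr_gt0// ltr0n.
have -> : pi / 2 * (4 * n%:R) = n.*2%:R * pi :> R.
  by rewrite -mul2n natrM; field.
by rewrite ltr_pM2r ?pi_gt0// ltr_nat -doubleS leq_double.
Qed.

(** With [y = x / 2n], Euler's coefficient is [sinh^2 y / sin^2 th] with [sinh] and [sin] replaced
    by their arguments. *)
Let cosh_coefE x n k : (0 < n)%N ->
  cosh_coef x k = (x / (2 * n%:R)) ^+ 2 / angle n k ^+ 2.
Proof.
move=> n0; rewrite /cosh_coef /angle.
have -> : k.*2.+1%:R = 2 * k%:R + 1 :> R by rewrite -natr1 -mul2n natrM.
rewrite -[k.+1%:R]natr1.
have := @pi_gt0 R; move: (@pi R) => p p0; field.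
rewrite !(gt_eqF p0) pnatr_eq0 -lt0n n0/=.
have k0 : 0 <= k%:R :> R by [].
by rewrite gt_eqF//; lra.
Qed.

(** Since [y <= sinh y] and [sin th <= th], each Euler factor is at most the matching factor of the
    finite identity. *)
Lemma prod_cosh_coef_le x n : 0 <= x ->
  \prod_(0 <= k < n) (1 + cosh_coef x k) <= cosh x.
Proof.
move=> x0; have [->|n0] := posnP n; first by rewrite big_geq// cosh_ge1.
rewrite (cosh_prod_sinh_sin x n0) big_seq [leRHS]big_seq.
apply: ler_prod => k; rewrite mem_index_iota => /andP[_ kn].
rewrite addr_ge0 ?cosh_coef_ge0//= lerD2l (cosh_coefE _ _ n0).
have y0 : 0 <= x / (2 * n%:R) by rewrite divr_ge0.
have s0 : 0 < sin (angle n k) by rewrite sin_gt0_pihalf// angle_gt0//= angle_lt.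
rewrite ler_pM ?sqr_ge0 ?invr_ge0 ?sqr_ge0//.
  by rewrite lerXn2r ?nnegrE ?sinh_ge0// sinh_ge.
rewrite lef_pV2 ?posrE ?exprn_gt0 ?angle_gt0// lerXn2r ?nnegrE ?(ltW s0)//.
  by rewrite ltW ?angle_gt0.
by rewrite sin_le_id// ltW ?angle_gt0.
Qed.

(** Each factor [1 + sinh y ^+ 2 / sin th ^+ 2] is bounded above by means of
    [sinh y <= y cosh y] and [1 / sin th ^+ 2 <= 1 / th ^+ 2 + 1]; the error is
    absorbed in an exponential, and [\sum_k cosh_coef x k <= cosh x] makes the
    total exponent tend to 0. *)
Lemma prod_cosh_coef_ge x n : 0 <= x -> (0 < n)%N ->
  let kappa : R := cosh (x / (2 * n%:R)) ^+ 2 in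
  cosh x <= \prod_(0 <= k < n) (1 + cosh_coef x k) *
    expR ((kappa - 1) * cosh x + x ^+ 2 / (4 * n%:R) * kappa).
Proof.
move=> x0 n0; lazy zeta; set kappa := cosh _ ^+ 2; set y := x / (2 * n%:R).
have n0' : n%:R != 0 :> R by rewrite pnatr_eq0 -lt0n.
have y0 : 0 <= y by rewrite divr_ge0.
have kappa1 : 0 <= kappa - 1 by rewrite subr_ge0 exprn_ege1// cosh_ge1.
(* With [a = cosh_coef x k], the bound on the [k]-th factor is [1 + y^2 kappa (1 / th^2 + 1) = 1 + a
   + z k], at most [(1 + a) (1 + z k) <= (1 + a) e^(z k)]. *)
pose z k := (kappa - 1) * cosh_coef x k + y ^+ 2 * kappa.
have kappa0 : 0 <= kappa by rewrite sqr_ge0.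
have z0 k : 0 <= z k.
  by rewrite addr_ge0// mulr_ge0// ?cosh_coef_ge0// sqr_ge0.
apply: (@le_trans _ _ (\prod_(0 <= k < n) ((1 + cosh_coef x k) * expR (z k)))).
  rewrite (cosh_prod_sinh_sin x n0) big_seq [leRHS]big_seq.
  apply: ler_prod => k; rewrite mem_index_iota => /andP[_ kn].
  rewrite addr_ge0 ?divr_ge0 ?sqr_ge0//=.
  have ak0 := angle_gt0 k n0.
  have s0 : 0 < sin (angle n k) by rewrite sin_gt0_pihalf// ak0/= angle_lt.
  apply: (@le_trans _ _ (1 + y ^+ 2 * kappa * ((angle n k ^+ 2)^-1 + 1))).
    rewrite lerD2l ler_pM ?sqr_ge0 ?invr_ge0 ?sqr_ge0//.
      rewrite -exprMn lerXn2r ?nnegrE ?sinh_ge0 ?sinh_le//.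
      by rewrite mulr_ge0// ltW// cosh_gt0.
    by rewrite invr_sin_sqr_le// ak0 angle_lt.
  apply: (@le_trans _ _ ((1 + cosh_coef x k) * (1 + z k))); last first.
    by rewrite ler_wpM2l ?addr_ge0 ?cosh_coef_ge0// expR_ge1Dx.
  rewrite -subr_ge0.
  have -> : (1 + cosh_coef x k) * (1 + z k) -
      (1 + y ^+ 2 * kappa * ((angle n k ^+ 2)^-1 + 1)) = cosh_coef x k * z k.
    by rewrite /z (cosh_coefE x k n0) -/y; ring.
  by rewrite mulr_ge0 ?cosh_coef_ge0.
rewrite big_split/= ler_wpM2l//.
  by rewrite prodr_ge0// => k _; rewrite addr_ge0 ?cosh_coef_ge0.
rewrite -expR_sum ler_expR big_split/= -mulr_sumr lerD//.
  rewrite ler_wpM2l// -(lerD2l 1).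
  apply: (le_trans (sum_le_prod1D n (cosh_coef_ge0 x))).
  by rewrite (le_trans (prod_cosh_coef_le n x0))// lerDr.
(* The [n] copies of [y^2 kappa] add up to [x^2 kappa / 4n], as [y = x / 2n]. *)
rewrite sumr_const_nat subn0 -mulr_natr le_eqVlt; apply/orP; left.
by apply/eqP; rewrite /y; field.
Qed.

(** The product lies between [cosh x e^(- e n)] and [cosh x], and [e n] tends to 0 because [kappa n]
    tends to 1. *)
Lemma cvg_prod_cosh_coef x : 0 <= x ->
  (fun n => \prod_(0 <= k < n) (1 + cosh_coef x k)) @ \oo --> cosh x.
Proof.
move=> x0; pose kappa n := cosh (x / (2 * n%:R)) ^+ 2.
pose e n := (kappa n - 1) * cosh x + x ^+ 2 / (4 * n%:R) * kappa n.
have inv0 : (fun n => (n%:R : R)^-1) @ \oo --> (0 : R).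
  apply/(@gtr0_cvgV0 _ _ _ _ (fun n => n%:R : R)); last exact: cvgr_idn.
  by near=> n; rewrite ltr0n; near: n; exists 1%N.
have c1 : cosh (x / (2 * n%:R)) @[n --> \oo] --> (1 : R).
  rewrite -[X in _ --> X]cosh0.
  apply: (@continuous_cvg _ _ _ \oo _ (fun n => x / (2 * n%:R)) cosh 0).
    apply: differentiable_continuous; apply/derivable1_diffP; exact: ex_derive.
  rewrite -(mulr0 (x / 2)).
  apply: (@cvg_trans _ ((fun n => x / 2 * n%:R^-1) @ \oo)).
    by apply: near_eq_cvg; near=> n; rewrite invfM mulrA.
  by apply: cvgM => //; exact: cvg_cst.
have k1 : kappa n @[n --> \oo] --> (1 : R).
  by rewrite -[X in _ --> X](mulr1 1); exact: (cvgM c1 c1).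
have e0 : e n @[n --> \oo] --> (0 : R).
  have -> : 0 = (1 - 1) * cosh x + (x ^+ 2 / 4 * 0) * 1 :> R by ring.
  apply: cvgD; apply: cvgM => //; [|exact: cvg_cst|].
    by apply: cvgB => //; exact: cvg_cst.
  apply: (@cvg_trans _ ((fun n => x ^+ 2 / 4 * n%:R^-1) @ \oo)).
    by apply: near_eq_cvg; near=> n; rewrite invfM mulrA.
  by apply: cvgM => //; exact: cvg_cst.
apply: (@squeeze_cvgr _ _ _ _ (fun n => cosh x * expR (- e n)) (fun=> cosh x)).
- near=> n; rewrite prod_cosh_coef_le// andbT.
  rewrite expRN ler_pdivrMr ?expR_gt0//; apply: prod_cosh_coef_ge => //.
  by near: n; exists 1%N.
- rewrite -[X in _ --> X]mulr1 -[X in _ * X](expR0 R) -oppr0.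
  apply: cvgM; first exact: cvg_cst.
  apply: (@continuous_cvg _ _ _ \oo _ (fun n => - e n) expR).
    exact: continuous_expR.
  exact: cvgN.
- exact: cvg_cst.
Unshelve. all: by end_near. Qed.

End cosh_product.

(** * The Laplace transform of PG(b,0) *)

Lemma gamma_pdf_ae_ge0 d (T : measurableType d) (R : realType)
    (P : probability T R) (b : R) (g : {RV P >-> R}) :
  has_pdf g (gamma_pdf b) -> {ae P, forall t, 0 <= g t}.
Proof.
move=> [_ _ gE]; exists (g @^-1` `]-oo, 0[%classic); split.
- by rewrite -[X in measurable X]setTI; exact: measurable_funPT.
- have := gE _ (measurable_itv `]-oo, 0[); rewrite /distribution /pushforward => ->.
  under eq_integral => x.
    rewrite inE /= in_itv /= => x0.
    rewrite /gamma_pdf patchE mem_setE in_itv /= andbT ltNge (ltW x0) /=.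
    over.
  by rewrite integral0.
- by move=> t /negP; rewrite -ltNge /= in_itv.
Qed.

Section polya_gamma0_laplace.
Context d (T : measurableType d) (R : realType) (P : probability T R).
Context (b : R) (g : nat -> {RV P >-> R}) (X : {RV P >-> R}).
Context (indg : mutually_independent g).
Context (gpdf : forall k, has_pdf (g k) (gamma_pdf b)).
Context (gX : {ae P, forall t, (fun K : nat => (2 * pi ^+ 2)^-1 *
  \sum_(0 <= k < K) g k t / (k.+1%:R - 2^-1) ^+ 2) @ \oo --> X t}).

Let ae_g_ge0 : {ae P, forall t k, 0 <= g k t}.
Proof. by apply/ae_foralln => k; exact: gamma_pdf_ae_ge0. Qed.

Let Xpos t := Num.max (X t) 0.

Lemma polya_gamma0_ae_ge0 : {ae P, forall t, 0 <= X t}.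
Proof.
near=> t; have Xt : (fun K : nat => (2 * pi ^+ 2)^-1 *
  \sum_(0 <= k < K) g k t / (k.+1%:R - 2^-1) ^+ 2) @ \oo --> X t.
  by near: t.
have gt0 : forall k, 0 <= g k t by near: t.
apply: (cvgr_to_ge Xt); apply: nearW => K.
apply: mulr_ge0; first by rewrite invr_ge0 mulr_ge0// sqr_ge0.
apply: sumr_ge0 => k _.
by rewrite divr_ge0 ?sqr_ge0.
Unshelve. all: by end_near. Qed.

(** Independence gives the expectation of the product of the first [K] exponential factors as
    [\prod_k (1 + a k)] to the power [- b]. As [K] grows, dominated convergence (all factors are at
    most 1) handles the integral and Euler's product the value. *)
Lemma polya_gamma0_laplace s : 0 <= s ->
  (\int[P]_t (expR (- (s ^+ 2 / 2 * Xpos t)))%:E =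
   (cosh (s / 2) `^ (- b))%:E)%E.
Proof.
(* [a k] is [s^2 / 2] times the weight [1 / (2 pi^2 (k + 1/2)^2)] of [g k] in the series. *)
move=> s0; pose a := cosh_coef (s / 2).
pose h k x := expR (- (a k * Num.max x 0)).
have a0 k : 0 <= a k by exact: cosh_coef_ge0.
have mh k : measurable_fun [set: R] (h k).
  apply: measurableT_comp => //; apply: measurableT_comp => //.
  apply: measurable_funM => //; exact: measurable_maxr.
have h01 k x : 0 <= h k x <= 1.
  by rewrite expR_ge0 -expR0 ler_expR oppr_le0 mulr_ge0// le_max lexx orbT.
pose F K t := \prod_(0 <= k < K) h k (g k t).
have F01 K t : 0 <= F K t <= 1.
  rewrite /F prodr_ge0/=; last by move=> k _; case/andP: (h01 k (g k t)).
  by rewrite prodr_ile1.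
have intF K : (\int[P]_t (F K t)%:E =
    ((\prod_(0 <= k < K) (1 + a k)) `^ (- b))%:E)%E.
  rewrite /F (expectation_prod_independent indg mh h01 (iota_uniq _ _)).
  rewrite -/(index_iota 0 K).
  elim: K => [|K IH]; first by rewrite !big_geq// powR1.
  rewrite !big_nat_recr//= powRM ?prodr_ge0// => [|k _|]; rewrite ?addr_ge0//.
  by rewrite EFinM -IH /h (gamma_pdf_laplace (gpdf K)).
have mF K : measurable_fun [set: T] (EFin \o F K).
  apply/measurable_EFinP; apply: measurable_prod => k _.
  exact: (measurableT_comp (mh k)).
have mXpos : measurable_fun [set: T] Xpos by exact: measurable_maxr.
have mE : measurable_fun [set: T] (fun t => (expR (- (s ^+ 2 / 2 * Xpos t)))%:E).
  apply/measurable_EFinP; apply: measurableT_comp => //.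
  by apply: measurableT_comp => //; exact: measurable_funM.
have FE : {ae P, forall t, [set: T] t ->
    (F K t)%:E @[K --> \oo] --> (expR (- (s ^+ 2 / 2 * Xpos t)))%:E}.
  near=> t => _; have Xt : (fun K : nat => (2 * pi ^+ 2)^-1 *
    \sum_(0 <= k < K) g k t / (k.+1%:R - 2^-1) ^+ 2) @ \oo --> X t.
    by near: t.
  have gt0 : forall k, 0 <= g k t by near: t.
  have Xt0 : 0 <= X t by near: t; exact: polya_gamma0_ae_ge0.
  rewrite /Xpos max_l//; apply: cvg_EFin; first by apply: nearW.
  have -> : fine \o (fun K => (F K t)%:E) = (fun K => expR (- (s ^+ 2 / 2 *
     ((2 * pi ^+ 2)^-1 * \sum_(0 <= k < K) g k t / (k.+1%:R - 2^-1) ^+ 2)))).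
    apply/funext => K /=; rewrite /F /h -expR_sum sumrN; congr (expR (- _)).
    rewrite mulrA mulr_sumr; apply: eq_bigr => k _.
    rewrite max_l// /a /cosh_coef; move: (@pi R) (pi_gt0 R) => p p0; field.
    have k0 : 0 <= k%:R :> R by [].
    apply/andP; split; first by rewrite gt_eqF//; lra.
    by rewrite gt_eqF.
  apply: (@continuous_cvg _ _ _ \oo _ _ expR); first exact: continuous_expR.
  by apply: cvgN; apply: cvgM => //; exact: cvg_cst.
have F1 : {ae P, forall t K, [set: T] t -> (`|(EFin \o F K) t| <= cst 1%:E t)%E}.
  apply: aeW => t K _; rewrite /= lee_fin.
  by case/andP: (F01 K t) => ? ?; rewrite ger0_norm.
have [_ _] := dominated_convergence measurableT mF mE FE
  (finite_measure_integrable_cst P 1 measurableT) F1.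
under eq_fun do rewrite intF.
move=> cvgL; apply: (cvg_unique _ cvgL) => //.
apply: cvg_EFin; first exact: nearW.
apply: (@continuous_cvg _ _ _ \oo _ _ (fun x => x `^ (- b))).
  apply: differentiable_continuous; apply/derivable1_diffP.
  by apply: derivable_powR; rewrite in_itv/= cosh_gt0.
by apply: cvg_prod_cosh_coef; rewrite divr_ge0.
Unshelve. all: by end_near. Qed.

End polya_gamma0_laplace.

(** * The mean of PG(b,z) *)

(** Differentiating in [s] rather than in the Laplace variable [s ^+ 2 / 2]
    avoids square roots. *)
Lemma mean_of_cosh_laplace d (T : measurableType d) (R : realType)
    (P : probability T R) (b s : R) (Y : T -> R) :
  measurable_fun [set: T] Y -> (forall t, 0 <= Y t) ->
  (forall u : R, 0 <= u -> (\int[P]_t (expR (- (u ^+ 2 / 2 * Y t)))%:E =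
    (cosh (u / 2) `^ (- b))%:E)%E) ->
  0 < s ->
  (\int[P]_t (Y t * expR (- (s ^+ 2 / 2 * Y t)))%:E =
   (b / (2 * s) * (sinh (s / 2) * cosh (s / 2) `^ (- b - 1)))%:E)%E.
Proof.
move=> mY Y0 LY s0.
pose f u t := expR (- (u ^+ 2 / 2 * Y t)).
have mf u : measurable_fun [set: T] (f u).
  apply: measurableT_comp => //.
  by apply: measurableT_comp => //; exact: measurable_funM.
have df (u : R) (t : T) : is_derive u 1 (f ^~ t) (- (u * (Y t * f u t))).
  by rewrite /f; apply: is_derive_eq; rewrite /GRing.scale /=; field.
have d1f (u : R) (t : T) : partial1of2 f u t = - (u * (Y t * f u t)).
  by rewrite partial1of2E derive_val.
have f01 u t : 0 <= f u t <= 1.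
  by rewrite expR_ge0 -expR0 ler_expR oppr_le0 mulr_ge0// divr_ge0 ?sqr_ge0.
have intf u : P.-integrable [set: T] (EFin \o f u).
  apply: le_integrable (finite_measure_integrable_cst P 1 measurableT) => //.
    exact/measurable_EFinP.
  move=> t _ /=; have /andP[? ?] := f01 u t.
  by rewrite lee_fin normr1 ger0_norm.
(* With [v = u^2 Y / 2], the left side times [u] is [2 v e^(- v)], at most 2 because [1 + v <= e^v].
   The bound is independent of [t]. *)
have f_ub u t : 0 < u -> u * (Y t * f u t) <= 2 / u.
  move=> u0; rewrite ler_pdivlMr//.
  have := expR_ge1Dx (u ^+ 2 / 2 * Y t).
  rewrite /f expRN; have := expR_gt0 (u ^+ 2 / 2 * Y t).
  move: (expR _) => e e0 ele.
  have -> : u * (Y t * e^-1) * u = 2 * (u ^+ 2 / 2 * Y t) / e.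
    by field; rewrite gt_eqF.
  by rewrite ler_pdivrMr//; lra.
have Fcosh : (fun u => \int[P]_t f u t) = (fun u => cosh (u / 2) `^ (- b)).
  (* Both sides are even in [u]. *)
  apply/funext => u; rewrite /Rintegral; wlog u0 : u / 0 <= u.
    move=> H; have [|/ltW u0] := leP 0 u; first exact: H.
    have := H (- u); rewrite oppr_ge0 => /(_ u0).
    by rewrite /f sqrrN mulNr /cosh opprK [in RHS]addrC.
  by rewrite LY.
(* Staying above [s / 2] bounds [2 / u] by the constant [4 / s], which dominates the derivative. *)
have ss : `]s / 2, 2 * s[%classic s by rewrite /= in_itv/=; lra.
have derf (u : R) (t : T) : `]s / 2, 2 * s[%classic u -> [set: T] t ->
    derivable (f ^~ t) u 1 by move=> _ _; exact: ex_derive.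
have d1ub (u : R) (t : T) : `]s / 2, 2 * s[%classic u -> [set: T] t ->
    `|partial1of2 f u t| <= 4 / s.
  rewrite /= in_itv/= => /andP[su _] _.
  have u0 : 0 < u by apply: lt_trans su; lra.
  have /andP[fut0 _] := f01 u t.
  rewrite d1f normrN ger0_norm ?mulr_ge0// ?(ltW u0)//.
  apply: (le_trans (f_ub u t u0)).
  rewrite ler_pdivlMr// mulrAC ler_pdivrMr//; lra.
have c0 : 0 <= 4 / s by rewrite divr_ge0// ltW.
have := @differentiation_under_integral R _ T P f setT measurableT s (s / 2)
  (2 * s) ss (fun u _ => intf u) derf (cst (4 / s)) (fun=> c0)
  (finite_measure_integrable_cst P (4 / s) measurableT) d1ub.
rewrite Fcosh.
have -> : derive1 (fun u => cosh (u / 2) `^ (- b)) s =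
    - (s * (b / (2 * s) * (sinh (s / 2) * cosh (s / 2) `^ (- b - 1)))).
  rewrite derive1E.
  have dg : is_derive s 1 (fun u : R => cosh (u / 2)) (sinh (s / 2) / 2).
    by apply: is_derive_eq; rewrite /GRing.scale /=; field.
  have dp := is_derive1_powR (- b) (cosh_gt0 (s / 2)).
  have := @is_derive1_comp R (fun v : R => v `^ (- b))
    (fun u => cosh (u / 2)) s _ _ dp dg.
  move=> /@derive_val /= => ->; field.
  by rewrite gt_eqF.
have mYf : measurable_fun [set: T] (fun t => Y t * f s t) by exact: measurable_funM.
have intYf : P.-integrable [set: T] (EFin \o (fun t => Y t * f s t)).
  apply: le_integrable
    (finite_measure_integrable_cst P (2 / s / s) measurableT) => //.
    exact/measurable_EFinP.
  move=> t _ /=; have /andP[? ?] := f01 s t.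
  rewrite lee_fin !ger0_norm ?divr_ge0 ?mulr_ge0 ?(ltW s0)//.
  by rewrite ler_pdivlMr// mulrC; exact: f_ub.
under eq_Rintegral do rewrite d1f -mulNr.
rewrite RintegralZl// -mulNr => /(mulfI _) -> //.
  by rewrite /Rintegral fineK//; exact: integrable_fin_num.
by rewrite oppr_eq0 gt_eqF.
Qed.

Lemma sinh_div_cosh_half (R : realType) (s : R) :
  sinh (s / 2) / cosh (s / 2) = (expR s - 1) / (1 + expR s).
Proof.
have -> : expR s = expR (s / 2) * expR (s / 2) by rewrite -expRD -splitr.
rewrite /sinh /cosh expRN.
have := expR_gt0 (s / 2); move: (expR _) => e e0; field.
have e2 : 0 < e * e by rewrite mulr_gt0.
by rewrite !gt_eqF//; lra.
Qed.

(** The law of [lam] is that of [X] weighted by [C e^(- z^2 x / 2)]. Total mass one makes [C] the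
    inverse of the Laplace transform, and the weighted first moment is known from its derivative. *)
Lemma polya_gamma_distributed_mean d (T : measurableType d) (R : realType)
    (Q : probability T R) (lam : {RV Q >-> R}) (b z : R) :
  0 < z -> polya_gamma_distributed lam b z ->
  ('E_Q[lam] =
    (b / (2 * z) * ((expR z - 1) / (1 + expR z)))%:E)%E.
Proof.
move=> z0 [f [f0 [d0 [T0 [P [g [X [indg gpdf gX Xf0]]]]]] [[C fE] intf]] lamf].
have [mf f_ge0 _] := lamf; have [mf0 f0_ge0 _] := Xf0.
pose e x : R := expR (- (z ^+ 2 * x / 2)).
have me : measurable_fun [set: R] e.
  apply: measurableT_comp => //; apply: measurableT_comp => //.
  by apply: measurable_funM => //; exact: measurable_funM.
(* Otherwise [f], being nonnegative, would vanish, against its integral being 1. *)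
have C0 : 0 < C.
  rewrite ltNge; apply/negP => C0; have fz x : f x = 0.
    apply/le_anti; rewrite f_ge0 andbT fE mulr_le0_ge0//.
    by rewrite mulr_ge0 ?expR_ge0.
  move: intf; under eq_integral do rewrite fz.
  by rewrite integral0 => /eqP; rewrite eq_sym onee_eq0.
have lamE (h : R -> R) : measurable_fun [set: R] h -> (forall x, 0 <= h x) ->
    (\int[Q]_t (h (lam t))%:E = C%:E * \int[P]_t (h (X t) * e (X t))%:E)%E.
  move=> mh h0.
  have mhe : measurable_fun [set: R] (fun x => (h x * e x)%:E).
    by apply/measurable_EFinP; exact: measurable_funM.
  have he0 x : (0 <= (h x * e x)%:E)%E by rewrite lee_fin mulr_ge0 ?expR_ge0.
  rewrite (ge0_integral_pdf (h := EFin \o h) lamf)//; last first.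
    exact/measurable_EFinP.
  rewrite (ge0_integral_pdf (h := fun x => (h x * e x)%:E) Xf0)//.
  rewrite -ge0_integralZl//.
  - apply: eq_integral => x _; rewrite /= fE -!EFinM; congr EFin.
    by rewrite /e; ring.
  - by apply: emeasurable_funM => //; exact/measurable_EFinP.
  - by move=> x _; rewrite mule_ge0// lee_fin.
  - by rewrite lee_fin ltW.
pose Y t := Num.max (X t) 0.
have mY : measurable_fun [set: T0] Y by exact: measurable_maxr.
have Y0 t : 0 <= Y t by rewrite /Y le_max lexx orbT.
have Xae := polya_gamma0_ae_ge0 gpdf gX.
have aeE (h : R -> R) : measurable_fun [set: R] h -> (forall x, 0 <= h x) ->
    (\int[P]_t (h (X t) * e (X t))%:E = \int[P]_t (h (Y t) * e (Y t))%:E)%E.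
  move=> mh h0.
  have mhe : measurable_fun [set: R] (fun x => (h x * e x)%:E).
    by apply/measurable_EFinP; exact: measurable_funM.
  apply: ge0_ae_eq_integral => //.
  - exact: (measurableT_comp mhe).
  - exact: (measurableT_comp mhe).
  - by move=> t _; rewrite lee_fin mulr_ge0 ?expR_ge0.
  - by move=> t _; rewrite lee_fin mulr_ge0 ?expR_ge0.
  near=> t => _; have Xt0 : 0 <= X t by near: t.
  by rewrite /Y max_l.
have eE t : e (Y t) = expR (- (z ^+ 2 / 2 * Y t)) by rewrite /e mulrAC.
(* Total mass: the case [h = 1] of [lamE]. *)
have CE : C * cosh (z / 2) `^ (- b) = 1.
  apply: EFin_inj; rewrite EFinM -(polya_gamma0_laplace indg gpdf gX (ltW z0)).
  have := lamE (fun=> 1) (measurable_cst _) (fun=> ler01).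
  rewrite (aeE (fun=> 1))//.
  under [in RHS]eq_integral do rewrite mul1r eE.
  move=> <-; rewrite integral_cst//= mul1e; exact: probability_setT.
(* Despite the names, [pos0] is about the negative part of [lam], which vanishes almost surely as
   [X] is almost surely nonnegative, and [neg0] about the positive part. *)
have pos0 : (\int[Q]_t (Num.max (- lam t) 0)%:E = 0)%E.
  rewrite (lamE (fun x => Num.max (- x) 0)); first last.
  - by move=> x; rewrite le_max lexx orbT.
  - by apply: measurable_maxr => //; exact: measurableT_comp.
  rewrite (aeE (fun x => Num.max (- x) 0)); first last.
  - by move=> x; rewrite le_max lexx orbT.
  - by apply: measurable_maxr => //; exact: measurableT_comp.
  under eq_integral do rewrite max_r ?oppr_le0// mul0r.
  by rewrite integral0 mule0.
have neg0 : (\int[Q]_t (Num.max (lam t) 0)%:E =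
    (b / (2 * z) * ((expR z - 1) / (1 + expR z)))%:E)%E.
  rewrite (lamE (fun x => Num.max x 0)); first last.
  - by move=> x; rewrite le_max lexx orbT.
  - exact: measurable_maxr.
  rewrite (aeE (fun x => Num.max x 0)); first last.
  - by move=> x; rewrite le_max lexx orbT.
  - exact: measurable_maxr.
  under eq_integral do rewrite max_l// eE.
  rewrite (mean_of_cosh_laplace mY Y0 (polya_gamma0_laplace indg gpdf gX) z0).
  rewrite -EFinM -sinh_div_cosh_half; congr EFin.
  rewrite powRD; last by rewrite (gt_eqF (cosh_gt0 _)) implybT.
  rewrite powR_inv1 ?(ltW (cosh_gt0 _))//.
  transitivity (b / (2 * z) * (sinh (z / 2) / cosh (z / 2)) *
    (C * cosh (z / 2) `^ (- b))); first by ring.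
  by rewrite CE mulr1.
rewrite expectation_def integralE.
rewrite (_ : (\int[Q]_x _^\- x)%E = 0%E) ?sube0; last first.
  rewrite -pos0; apply: eq_integral => t _.
  by rewrite funenegE EFin_max.
by rewrite -neg0; apply: eq_integral => t _; rewrite funeposE EFin_max.
Unshelve. all: by end_near. Qed.

(** * Comparison of the two objectives *)

Lemma Lfun2_omega d (T : measurableType d) (R : realType)
    (P : probability T R) (N D : nat) (X : 'I_N -> 'I_D -> {RV P >-> R})
    (n : 'I_N) (w : 'cV[R]_D) :
  (forall i, (X n i : T -> R) \in Lfun P 2%:E) ->
  omega X n w \in Lfun P 2%:E.
Proof.
move=> X2; have -> : omega X n w = fun t => \sum_i w i 0 * X n i t.
  by apply/funext => t; rewrite /omega mxE; apply: eq_bigr => i _; rewrite !mxE.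
elim: (index_enum _) => [|i r IH].
  rewrite (_ : (fun _ => _) = cst 0) ?Lfun_cst//.
  by apply/funext => t; rewrite big_nil.
rewrite (_ : (fun _ => _) =
  (w i 0 \o* (X n i : T -> R)) \+ (fun t => \sum_(i <- r) w i 0 * X n i t)).
  by rewrite rpredD ?lee1n//= => _; rewrite Lfun_scale// ler1n.
by apply/funext => t; rewrite big_cons/= mulrC.
Qed.

Lemma expectation_sqrB d (T : measurableType d) (R : realType)
    (P : probability T R) (f : T -> R) (a : R) : f \in Lfun P 2%:E ->
  fine 'E_P[fun t => (f t - a) ^+ 2] =
  fine 'E_P[fun t => f t ^+ 2] - 2 * a * fine 'E_P[f] + a ^+ 2.
Proof.
move=> f2.
(* Integrability of [f] and [f^2] makes the expectations finite, so that [fine] respects sums. *)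
have f1 : f \in Lfun P 1 by rewrite Lfun_subset12 ?fin_num_measure.
have ff : (fun t => f t ^+ 2) \in Lfun P 1 by exact: Lfun2_mul_Lfun1.
rewrite (_ : (fun t => (f t - a) ^+ 2) =
    (fun t => f t ^+ 2) \+ ((- 2 * a) \o* f \+ cst (a ^+ 2))); last first.
  by apply/funext => t /=; ring.
rewrite !expectationD ?rpredD ?Lfun_scale ?Lfun_cst//.
rewrite expectationZl// expectation_cst.
have E1 := expectation_fin_num f1; have E2 := expectation_fin_num ff.
rewrite !fineD ?fin_numD ?fin_numM//= fineM//=; ring.
Qed.

Theorem lemma3 (R : realType) (N D : nat) (c : R)
  (x : 'I_N -> 'cV[R]_D) (y : 'I_N -> R)
  (d : measure_display) (T : measurableType d) (P : probability T R)
  (X : 'I_N -> 'I_D -> {RV P >-> R})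
  (wbar : 'cV[R]_D) (s : 'I_N -> R)
  (d' : measure_display) (T' : measurableType d') (Q : probability T' R)
  (lambda : 'I_N -> {RV Q >-> R})
  (gamma yl gammal : 'I_N -> R) :
  0 < c ->
  (forall n, y n = 1 \/ y n = -1) ->
  corruption x X ->
  (forall n, s n = Num.sqrt (fine 'E_P[fun t => omega X n wbar t ^+ 2])) ->
  (forall n, 0 < s n) ->
  mutually_independent lambda ->
  (forall n, polya_gamma_distributed (lambda n) c (s n)) ->
  (forall n, gamma n = fine 'E_Q[lambda n]) ->
  (forall n, yl n = c / (2 * gamma n) * y n) ->
  (forall n, gammal n = gamma n / c) ->
  (forall w : 'cV[R]_D,
     minimizer (mstep_objective X lambda y c) w <->
     minimizer (reweighted_objective X yl gammal c) w) /\
  (forall n, ('E_Q[lambda n] = (gamma n)%:E)%E /\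
     gamma n = c / (2 * s n) * ((expR (s n) - 1) / (1 + expR (s n)))).
Proof.
move=> c0 _ [_ X2 _] _ s0 _ lamPG gammaE ylE gammalE.
have lamE n := polya_gamma_distributed_mean (s0 n) (lamPG n).
have gE n : gamma n = c / (2 * s n) * ((expR (s n) - 1) / (1 + expR (s n))).
  by rewrite gammaE lamE.
have g0 n : 0 < gamma n.
  rewrite gE; apply: mulr_gt0; first by rewrite divr_gt0// mulr_gt0.
  apply: divr_gt0; first by rewrite subr_gt0 expR_gt1.
  by rewrite addr_gt0 ?expR_gt0.
split=> [w|n]; last by split=> //; rewrite lamE gE.
(* Termwise [c / 2 * gammal = gamma / 2] and [c * gammal * yl = c / 2 * y], so only the squares of
   [yl] remain. *)
have objE v : reweighted_objective X yl gammal c v =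
    mstep_objective X lambda y c v + c / 2 * \sum_n gammal n * yl n ^+ 2.
  rewrite /reweighted_objective /mstep_objective -addrA; congr (_ + _).
  rewrite !mulr_sumr -big_split; apply: eq_bigr => n _ /=.
  rewrite expectation_sqrB; last exact: Lfun2_omega.
  rewrite -gammaE ylE gammalE.
  by field; rewrite !gt_eqF.
by split=> wmin v; have := wmin v; rewrite !objE lerD2r.
Qed.
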